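(* Let $s,t\geq 2$ be integers and let $G$ be a (finite, simple) $r$-regular graph. Suppose $\mu$ is a non-main eigenvalue of $G$ and $X\subset V(G)$ is a star set for $\mu$ in $G$ such that the induced subgraph $H:=G-X$ is isomorphic to $K_s\nabla tK_1$ (the complete graph $K_s$ joined to $t$ isolated vertices, i.e. the complete multipartite graph $\overline{sK_1\cup K_t}$). If $t+\mu=0$, then $\mu=-2$, $t=2$ and $G$ is isomorphic to $\overline{(s+1)K_2}$, the complement of a perfect matching on $2s+2$ vertices (equivalently, $K_{2s+2}$ with a perfect matching deleted).
   Context: For a graph $G$ with adjacency matrix $A(G)$ and an eigenvalue $\mu$ of multiplicity $k$, a star set for $\mu$ in $G$ is a subset $X\subset V(G)$ with $|X|=k$ such that $\mu$ is not an eigenvalue of the induced subgraph $G-X$; $G-X$ is then called a star complement for $\mu$. An eigenvalue $\mu$ is non-main if its eigenspace $\{\mathbf{x}: A(G)\mathbf{x}=\mu\mathbf{x}\}$ is orthogonal to the all-ones vector. The join $G_1\nabla G_2$ is obtained from disjoint copies of $G_1$ and $G_2$ by joining every vertex of $G_1$ to every vertex of $G_2$. *)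

(* Defs.v *)
From HB Require Import structures.
From mathcomp Require Import all_boot all_order all_algebra.
From mathcomp Require Import reals.

Set Implicit Arguments.
Unset Strict Implicit.
Unset Printing Implicit Defensive.

Import GRing.Theory Num.Theory.
Local Open Scope ring_scope.

Record sgraph := SGraph {
  vertex :> finType;
  adj : rel vertex;
  adj_sym : symmetric adj;
  adj_irrefl : irreflexive adj }.

Definition isomorphic (G1 G2 : sgraph) : Prop :=
  exists f : G1 -> G2, bijective f /\ forall x y, adj (f x) (f y) = adj x y.

Definition regular (G : sgraph) (r : nat) : Prop :=
  forall x : G, #|[set y : G | adj x y]| = r.

Section Deletion.
Variables (G : sgraph) (X : {set G}).
Definition delete_adj : rel {x : G | x \notin X} :=
  fun x y => adj (val x) (val y).
Lemma delete_sym : symmetric delete_adj.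
Proof. by move=> x y; exact: adj_sym. Qed.
Lemma delete_irrefl : irreflexive delete_adj.
Proof. by move=> x; exact: adj_irrefl. Qed.
Definition delete : sgraph := SGraph delete_sym delete_irrefl.
End Deletion.

Section Complement.
Variable G : sgraph.
Definition compl_adj : rel G := fun x y => (x != y) && ~~ adj x y.
Lemma compl_sym : symmetric compl_adj.
Proof. by move=> x y; rewrite /compl_adj eq_sym adj_sym. Qed.
Lemma compl_irrefl : irreflexive compl_adj.
Proof. by move=> x; rewrite /compl_adj eqxx. Qed.
Definition compl : sgraph := SGraph compl_sym compl_irrefl.
End Complement.

Section Join.
Variables G1 G2 : sgraph.
Definition join_adj : rel (G1 + G2)%type := fun x y =>
  match x, y with
  | inl a, inl b => adj a b
  | inr a, inr b => adj a b
  | _, _ => true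
  end.
Lemma join_sym : symmetric join_adj.
Proof. by case=> x [] y //=; exact: adj_sym. Qed.
Lemma join_irrefl : irreflexive join_adj.
Proof. by case=> x /=; exact: adj_irrefl. Qed.
Definition join : sgraph := SGraph join_sym join_irrefl.
End Join.

(* mG, the disjoint union of m copies of G *)
Section Copies.
Variables (m : nat) (G : sgraph).
Definition copies_adj : rel ('I_m * G)%type :=
  fun x y => (x.1 == y.1) && adj x.2 y.2.
Lemma copies_sym : symmetric copies_adj.
Proof. by move=> x y; rewrite /copies_adj eq_sym adj_sym. Qed.
Lemma copies_irrefl : irreflexive copies_adj.
Proof. by move=> x; rewrite /copies_adj adj_irrefl andbF. Qed.
Definition copies : sgraph := SGraph copies_sym copies_irrefl.
End Copies.

Section Complete.
Variable n : nat.
Definition complete_adj : rel 'I_n := fun x y => x != y.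
Lemma complete_sym : symmetric complete_adj.
Proof. by move=> x y; rewrite /complete_adj eq_sym. Qed.
Lemma complete_irrefl : irreflexive complete_adj.
Proof. by move=> x; rewrite /complete_adj eqxx. Qed.
Definition complete : sgraph := SGraph complete_sym complete_irrefl.
End Complete.

Definition adjmx (R : realType) (G : sgraph) : 'M[R]_#|G| :=
  \matrix_(i, j) (adj (enum_val i) (enum_val j))%:R.

(* MathComp's eigenvalue and eigenspace use row vectors; as the adjacency
   matrix is symmetric, this is the same as A x = mu x on column vectors. *)
Definition graph_eigenvalue (R : realType) (G : sgraph) (mu : R) : Prop :=
  eigenvalue (adjmx R G) mu.

Definition multiplicity (R : realType) (G : sgraph) (mu : R) : nat :=
  \rank (eigenspace (adjmx R G) mu).

Definition non_main (R : realType) (G : sgraph) (mu : R) : Prop :=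
  forall x : 'cV[R]_#|G|,
    adjmx R G *m x = mu *: x -> (const_mx 1 : 'cV[R]_#|G|)^T *m x = 0.

Definition star_set (R : realType) (G : sgraph) (mu : R) (X : {set G}) : Prop :=
  #|X| = multiplicity G mu /\ ~ graph_eigenvalue (delete X) mu.

(* Main.v *)
(** The eigenspace of [mu] has dimension [#|X|], and an eigenvector vanishing on
    the star set [X] restricts to an eigenvector of [G - X], hence is zero. So for
    each [u] in [X] some eigenvector [x] restricts on [X] to the indicator of
    [u]. Let [S] and [T] be the vertex sets of [K_s] and [tK_1], and let [a], [b]
    be the sums of [x] over [S] and [T]. As [mu] is non-main, [1 + a + b = 0].
    With [mu = - t], summing the eigenvalue equations over [T] shows that [u] is
    adjacent to all of [T]; those at the vertices [v] of [S] read
    [(t - 1) * x v = 1] if [v] is not adjacent to [u] and [0] otherwise; the one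
    at [u] gives [b = - t], hence [a = t - 1]. So [u] has exactly [(t - 1)^2]
    non-neighbours in [S].

    A vertex of [T] has [t - 1] non-neighbours, so by regularity every vertex
    does. Non-neighbours of a vertex of [S] lie in [X], so [X] is nonempty and
    [(t - 1)^2 <= t - 1], that is [t = 2]: the complement of [G] is a perfect
    matching, which pairs the two vertices of [T] and matches [S] with [X]. *)
Require Import Defs.
From HB Require Import structures.
From mathcomp Require Import all_boot all_order all_algebra.
From mathcomp Require Import reals.
From mathcomp Require Import lra zify.

Set Implicit Arguments.
Unset Strict Implicit.
Unset Printing Implicit Defensive.

Import GRing.Theory Num.Theory.
Local Open Scope ring_scope.

(** * Eigenvectors as functions on the vertices, and star sets *)

Definition eigenfun (R : realType) (G : sgraph) (mu : R) (x : G -> R) : Prop :=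
  forall v, \sum_(w | adj v w) x w = mu * x v.

(** Bridges row vectors and vertex functions; symmetry of [adj] turns the column sums of the product
    into sums over neighbours. *)
Lemma eigenfunP (R : realType) (G : sgraph) (mu : R) (x : G -> R) :
  (\row_i x (enum_val i)) *m adjmx R G = mu *: (\row_i x (enum_val i)) <->
  eigenfun mu x.
Proof.
have entry v : ((\row_i x (enum_val i)) *m adjmx R G) 0 (enum_rank v) =
    \sum_(w | adj v w) x w.
  rewrite mxE [RHS]big_mkcond /= (reindex (@enum_val _ (mem G))) /=; last first.
    exact: onW_bij (enum_val_bij _).
  apply: eq_bigr => i _; rewrite !mxE enum_rankK adj_sym.
  by case: ifP; rewrite ?mulr1 ?mulr0.
split=> [/rowP E v | E].
  by rewrite -entry E !mxE enum_rankK.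
by apply/rowP=> i; rewrite -[i]enum_valK entry E !mxE enum_rankK.
Qed.

Section EigenFunctions.
Variables (R : realType) (G : sgraph) (mu : R).

Lemma non_main_sum (x : G -> R) :
  non_main G mu -> eigenfun mu x -> \sum_v x v = 0.
Proof.
move=> nm /eigenfunP E.
have adjT : (adjmx R G)^T = adjmx R G.
  by apply/matrixP=> i j; rewrite !mxE adj_sym.
have /nm : adjmx R G *m (\row_i x (enum_val i))^T =
    mu *: (\row_i x (enum_val i))^T.
  by rewrite -{1}adjT -trmx_mul E linearZ.
move/matrixP/(_ 0 0); rewrite !mxE => sum0; rewrite -[RHS]sum0.
rewrite (reindex (@enum_val _ (mem G))) /=; last exact: onW_bij (enum_val_bij _).
by apply: eq_bigr => i _; rewrite !mxE mul1r.
Qed.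

Lemma eigenfun_vanishing_on (X : {set G}) (x : G -> R) :
  ~ graph_eigenvalue (delete X) mu -> eigenfun mu x ->
  {in X, forall v, x v = 0} -> forall v, x v = 0.
Proof.
move=> noev ex x0 v; have [/x0 //|vX] := boolP (v \in X).
pose y (w : delete X) := x (val w).
have ey : eigenfun mu y.
  move=> w; rewrite /y -ex [RHS](bigID (mem X)) /= [X in _ = X + _]big1 ?add0r; last first.
    by move=> u /andP[_ /x0].
  rewrite [RHS](eq_bigl (fun u => (u \in [pred z | z \notin X]) && adj (val w) u)).
    by rewrite (big_sub_cond [pred z | z \notin X]).
  by move=> u; rewrite inE andbC.
have y0 : \row_(i < #|delete X|) y (enum_val i) = 0.
  apply/eqP; apply/negPn/negP=> nz; apply: noev; apply/eigenvalueP.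
  by exists (\row_(i < #|delete X|) y (enum_val i)) => //; apply/eigenfunP.
move/rowP: y0 => /(_ (enum_rank (Sub v vX : delete X))).
by rewrite !mxE enum_rankK /y.
Qed.

(* The eigenspace has dimension #|X| and restricts injectively to X, so the
   restriction is onto. *)
Lemma star_set_eigenfun (X : {set G}) (u : G) :
  star_set mu X -> u \in X ->
  exists x : G -> R, [/\ eigenfun mu x, x u = 1 &
                         {in X, forall v, v != u -> x v = 0}].
Proof.
move=> [cX noev] uX.
(* Right multiplication by [D] keeps only the coordinates in [X], so [E *m D] is a basis of the
   eigenspace restricted to [X]. *)
pose E := row_base (eigenspace (adjmx R G) mu).
pose D : 'M[R]_(#|G|, #|X|) :=
  \matrix_(i, j) (enum_val i == enum_val j)%:R.
have rowfun (z : 'rV[R]_#|G|) : z = \row_i z 0 (enum_rank (enum_val i)).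
  by apply/rowP=> i; rewrite mxE enum_valK.
have zD (z : 'rV[R]_#|G|) j : (z *m D) 0 j = z 0 (enum_rank (enum_val j)).
  rewrite mxE (bigD1 (enum_rank (enum_val j))) //= mxE enum_rankK eqxx mulr1.
  rewrite big1 ?addr0 // => i /negPf ne; rewrite mxE.
  by rewrite -[_ == _](can_eq enum_rankK) enum_valK ne mulr0.
have eigE m (W : 'M_(m, _)) : (W *m E) *m adjmx R G = mu *: (W *m E).
  by apply/eigenspaceP; rewrite (submx_trans (submxMl _ _)) // eq_row_base.
have ezfun (w : 'rV_(\rank (eigenspace (adjmx R G) mu))) :
    eigenfun mu (fun v => (w *m E) 0 (enum_rank v)).
  by apply/eigenfunP; rewrite -rowfun.
have free : row_free (E *m D).
  apply: inj_row_free => w; rewrite mulmxA => wED.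
  apply: (row_free_inj (row_base_free (eigenspace (adjmx R G) mu))).
  rewrite mul0mx; apply/rowP=> i; rewrite [RHS]mxE -[i]enum_valK.
  apply: (eigenfun_vanishing_on noev (ezfun w)) => v vX.
  by rewrite -(enum_rankK_in vX vX) -zD wED mxE.
(* The dimension of the eigenspace is [#|X|], so [E *m D] is square and independent rows span. *)
have full : row_full (E *m D).
  by move: free; rewrite /row_free /row_full => /eqP->; rewrite cX.
have /submxP[w Ew] := submx_full (delta_mx 0 (enum_rank_in uX u) : 'rV[R]_#|X|) full.
have val_w v (vX : v \in X) :
    (w *m E) 0 (enum_rank v) = (v == u)%:R.
  rewrite -{1}(enum_rankK_in uX vX) -zD -mulmxA -Ew mxE eqxx /=.
  congr (nat_of_bool _)%:R; apply/eqP/eqP=> [|-> //].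
  by move/(congr1 enum_val); rewrite !enum_rankK_in.
exists (fun v => (w *m E) 0 (enum_rank v)); split=> //.
  by rewrite val_w // eqxx.
by move=> v vX /negPf ne; rewrite val_w // ne.
Qed.

End EigenFunctions.

(** * The star complement and the neighbours of a star vertex *)

Lemma join_split (G : sgraph) (X : {set G}) (s t : nat) :
  isomorphic (delete X) (join (complete s) (copies t (complete 1))) ->
  exists S T : {set G},
    [/\ [disjoint X & S], T = ~: (X :|: S), #|S| = s & #|T| = t] /\
    [/\ {in S &, forall v w, adj v w = (v != w)},
        {in S & T, forall v w, adj v w} &
        {in T &, forall v w, adj v w = false}].
Proof.
move=> [f [[g fK gK] fadj]].
pose h z := val (g z).
have hX z : h z \notin X by rewrite /h; case: (g z).
have h_inj : injective h by move=> a b /val_inj/(can_inj gK).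
have hadj a b : adj (h a) (h b) = adj a b.
  by rewrite -[in RHS](gK a) -[in RHS](gK b) fadj.
have hsurj v : v \notin X -> exists z, v = h z.
  by move=> vX; exists (f (Sub v vX)); rewrite /h fK.
pose S := [set h (inl i) | i : 'I_s].
pose T := [set h (inr p) | p : 'I_t * 'I_1].
exists S, T; split; first split.
- rewrite disjoint_sym disjoint_subset; apply/subsetP => _ /imsetP[i _ ->].
  by rewrite inE hX.
- apply/setP=> v; rewrite !inE negb_or; apply/imsetP/andP.
    move=> [p _ ->]; split; first exact: hX.
    by apply/imsetP=> -[i _ /h_inj].
  move=> [/hsurj[[i|p] ->] nS]; last by exists p.
  by case/imsetP: nS; exists i.
- by rewrite card_imset ?card_ord // => i j /h_inj[].
- rewrite card_imset ?card_prod ?card_ord ?muln1 // => i j /h_inj[] //.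
- split=> v w.
  + move=> /imsetP[i _ ->] /imsetP[j _ ->].
    by rewrite hadj (inj_eq h_inj).
  + by move=> /imsetP[i _ ->] /imsetP[j _ ->]; rewrite hadj.
  + move=> /imsetP[[i a] _ ->] /imsetP[[j b] _ ->]; rewrite hadj /=.
    (* ['I_1] has a single element, so the copies have no edges. *)
    by rewrite /copies_adj /= /complete_adj !ord1 eqxx andbF.
Qed.

Lemma star_vertex_neighbours (R : realType) (G : sgraph) (t : nat)
    (X S T : {set G}) (u : G) :
  (2 <= t)%N -> non_main G (- t%:R : R) -> star_set (- t%:R : R) X ->
  [disjoint X & S] -> T = ~: (X :|: S) -> #|T| = t ->
  {in S &, forall v w, adj v w = (v != w)} ->
  {in S & T, forall v w, adj v w} ->
  {in T &, forall v w, adj v w = false} ->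
  u \in X ->
  {in T, forall v, adj u v} /\
  #|[set v in S | ~~ adj u v]| = ((t - 1) ^ 2)%N.
Proof.
move=> t2 nm stX dXS defT cT aSS aST aTT uX.
have [x [ex xu xX]] := star_set_eigenfun stX uX.
(* Within [X], only [u] contributes. *)
have split_sum (P : pred G) : \sum_(w | P w) x w =
    (P u)%:R + \sum_(w in S | P w) x w + \sum_(w in T | P w) x w.
  rewrite (bigID (mem X)) /= -addrA; congr (_ + _).
    rewrite (bigID (pred1 u)) /= addrC big1 ?add0r; last first.
      by move=> w /andP[/andP[_ wX] /(xX _ wX)].
    case Pu: (P u).
      rewrite (big_pred1 u) // => w /=.
      by case: eqVneq => [->|]; rewrite ?andbF // Pu uX.
    rewrite big1 // => w /andP[/andP[Pw _] /eqP wu].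
    by rewrite wu Pu in Pw.
  rewrite (bigID (mem S)) /=; congr (_ + _); apply: eq_bigl => w.
    have := disjointFl dXS (x := w); rewrite andbC.
    by case: (w \in S) => // /(_ isT) ->; rewrite andbT.
  by rewrite defT !inE negb_or -andbA andbC.
set sS := \sum_(w in S) x w; set sT := \sum_(w in T) x w.
have sum0 : 1 + sS + sT = 0.
  rewrite -(non_main_sum nm ex) split_sum /=.
  by congr (_ + _ + _); apply: eq_bigl => w; rewrite andbT.
have eqT v : v \in T -> (adj u v)%:R + sS = - t%:R * x v.
  move=> vT; rewrite -ex split_sum adj_sym.
  rewrite [X in _ = _ + X]big1 ?addr0; last first.
    by move=> w /andP[wT]; rewrite aTT.
  congr (_ + _); apply: eq_bigl => w.
  by case wS: (w \in S) => //=; rewrite adj_sym aST.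
have eqS v : v \in S -> (t%:R - 1) * x v = (~~ adj u v)%:R.
  move=> vS.
  have := ex v; rewrite split_sum [adj v u]adj_sym.
  have -> : \sum_(w in S | adj v w) x w = sS - x v.
    rewrite /sS [in RHS](bigD1 v) //= addrAC subrr add0r; apply: eq_bigl => w.
    by case wS: (w \in S) => //=; rewrite aSS // eq_sym.
  have -> : \sum_(w in T | adj v w) x w = sT.
    apply: eq_bigl => w.
    by case wT: (w \in T) => //=; rewrite aST.
  have -> : sT = - 1 - sS by lra.
  by case: (adj u v) => /= H; lra.
have t1 : (t%:R - 1 : R) != 0 by rewrite subr_eq0 pnatr_eq1; lia.
have adjT : {in T, forall v, adj u v}.
  (* Summing [eqT] gives [#|[set v in T | adj u v]| + t * sS = - t * sT], and [sT = - 1 - sS]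
     cancels [sS]. *)
  have cardT : #|[set v in T | adj u v]| = t.
    apply/eqP; rewrite -(eqr_nat R); apply/eqP.
    have : \sum_(v in T) ((adj u v)%:R + sS) = - t%:R * sT.
      by rewrite /sT mulr_sumr; apply: eq_bigr.
    rewrite big_split /= sumr_const cT -[sS *+ t]mulr_natl -natr_sum.
    have -> : sT = - 1 - sS by lra.
    rewrite -sum1dep_card big_mkcondr /= => H.
    have -> : (\sum_(v in T) (if adj u v then 1 else 0) = \sum_(v in T) adj u v)%N.
      by apply: eq_bigr => v _; case: (adj u v).
    by lra.
  have /eqP E : [set v in T | adj u v] == T.
    rewrite eqEcard cardT cT leqnn andbT.
    by apply/subsetP=> v; rewrite inE => /andP[].
  by move=> v; rewrite -E inE => /andP[].
split=> //.
(* In the equation at [u], neighbours in [S] have value [0] by [eqS], and all of [T] is adjacent to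
   [u]. *)
have eqU : sT = - t%:R.
  have := ex u; rewrite xu mulr1 split_sum adj_irrefl add0r big1 ?add0r.
    move=> <-; apply: eq_bigl => w.
    by case wT: (w \in T) => //=; rewrite adjT.
  move=> w /andP[wS uw]; have := eqS w wS; rewrite uw /= => /eqP.
  by rewrite mulf_eq0 (negPf t1) => /eqP.
have m_val : (t%:R - 1) * sS = #|[set v in S | ~~ adj u v]|%:R.
  rewrite /sS mulr_sumr (eq_bigr _ eqS) -natr_sum -sum1dep_card.
  by rewrite [in RHS]big_mkcondr.
apply/eqP; rewrite -(eqr_nat R) -m_val natrX natrB; last by lia.
have -> : sS = t%:R - 1 by lra.
by rewrite expr2.
Qed.

(** * Recognising the complement of a perfect matching *)

(** The non-edges are the pairs exchanged by [p], and [A] meets each pair once. A vertex is coded by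
    the member of its pair in [A] and a bit telling whether it is that member. *)
Lemma isomorphic_cocktail_party (G : sgraph) (p : G -> G) (A : {set G}) (m : nat) :
  #|A| = m.+1 -> involutive p ->
  (forall v, (p v \in A) = (v \notin A)) ->
  (forall v w, adj v w = (v != w) && (w != p v)) ->
  isomorphic G (compl (copies m.+1 (complete 2))).
Proof.
move=> cA pK pA adjE; rewrite -cA.
(* An element of [A] is the default that [enum_rank_in] requires. *)
have [a aA] : exists a, a \in A by apply/set0Pn; rewrite -card_gt0 cA.
pose rk := enum_rank_in aA.
pose o0 : 'I_2 := ord0; pose o1 : 'I_2 := ord_max.
pose f v : 'I_#|A| * 'I_2 := if v \in A then (rk v, o0) else (rk (p v), o1).
pose g (z : 'I_#|A| * 'I_2) : G :=
  if z.2 == o0 then enum_val z.1 else p (enum_val z.1).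
have fK : cancel f g.
  move=> v; rewrite /f /g /rk; case vA: (v \in A) => /=.
    by rewrite enum_rankK_in.
  by rewrite enum_rankK_in ?pK // pA vA.
have gK : cancel g f.
  move=> [i b]; rewrite /f /g /=; case: eqVneq => [->|b0].
    by rewrite enum_valP /rk enum_valK_in.
  rewrite pA enum_valP /= pK /rk enum_valK_in; congr (_, _).
  by apply: val_inj; case: b b0 => -[|[|]].
exists f; split; first by exists g.
move=> v w; rewrite adjE /= /compl_adj (can_eq fK); congr (_ && ~~ _).
have rkE y z : y \in A -> z \in A -> (rk y == rk z) = (y == z).
  move=> yA zA; apply/eqP/eqP => [|-> //].
  by rewrite /rk => /(congr1 enum_val); rewrite !enum_rankK_in.
rewrite /f; case vA: (v \in A); case wA: (w \in A);
  rewrite /= /copies_adj /= /complete_adj /=.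
- rewrite andbF; apply/esym/eqP => wpv.
  by move: wA; rewrite wpv pA vA.
- rewrite andbT rkE // ?pA ?wA //.
  by apply/eqP/eqP => ->; rewrite pK.
- by rewrite andbT rkE // ?pA ?vA // eq_sym.
- rewrite andbF; apply/esym/eqP => wpv.
  by move: wA; rewrite wpv pA vA.
Qed.

(** * Counting non-neighbours and building the matching *)

Theorem theorem3p1 (R : realType) (s t r : nat) (hs : (2 <= s)%N)
    (ht : (2 <= t)%N) (G : sgraph) (hG : regular G r) (mu : R)
    (hmu : graph_eigenvalue G mu) (hnm : non_main G mu)
    (X : {set G}) (hX : star_set mu X)
    (hH : isomorphic (delete X) (join (complete s) (copies t (complete 1))))
    (htmu : t%:R + mu = 0) :
  [/\ mu = - 2, t = 2%N & isomorphic G (compl (copies s.+1 (complete 2)))].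
Proof.
have def_mu : mu = - t%:R by lra.
rewrite {}def_mu {mu hmu htmu} in hnm hX *.
have [S [T [[dXS defT cS cT] [aSS aST aTT]]]] := join_split hH.
have XP u : u \in X -> {in T, forall v, adj u v} /\
    #|[set v in S | ~~ adj u v]| = ((t - 1) ^ 2)%N.
  exact: star_vertex_neighbours hnm hX dXS defT cT aSS aST aTT.
(* [N v] contains [v] itself; the proper non-neighbours form [N v :\ v]. *)
pose N (v : G) := [set w : G | ~~ adj v w].
have NN v : v \in N v by rewrite inE adj_irrefl.
have NC v w : (w \in N v) = (v \in N w) by rewrite !inE adj_sym.
have NT v : v \in T -> N v = T.
  move=> vT; apply/setP=> w; rewrite inE.
  have [wT|] := boolP (w \in T); first by rewrite aTT.
  rewrite {1}defT inE negbK => /setUP[/XP[aT _]|wS].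
    by rewrite adj_sym aT.
  by rewrite adj_sym aST.
(* Regularity makes [#|N v|] constant, and it is [#|T|] at a vertex of [T]. *)
have cN v : #|N v| = t.
  have cNr w : (#|N w| + r = #|G|)%N.
    rewrite -(hG w) -cardsT -(cardsID (N w) setT); congr (_ + _)%N.
      by rewrite setTI.
    by rewrite setTD; apply: eq_card => z; rewrite !inE negbK.
  have [v0 v0T] : exists v0, v0 \in T.
    by apply/set0Pn; rewrite -card_gt0 cT; lia.
  by have := cNr v; have := cNr v0; rewrite (NT v0 v0T) cT; lia.
have NS v w : v \in S -> w \in N v -> w != v -> w \in X.
  move=> vS; rewrite inE => nvw wv; apply: contraNT nvw => wX.
  have [wS|nwS] := boolP (w \in S); first by rewrite aSS // eq_sym.
  by apply: aST => //; rewrite defT !inE negb_or wX.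
have ND v : #|N v :\ v| = t.-1 by have := cardsD1 v (N v); rewrite NN cN; lia.
have NSX u : u \in X -> [set v in S | ~~ adj u v] \subset N u :\ u.
  move=> uX; apply/subsetP => v; rewrite !inE => /andP[vS ->]; rewrite andbT.
  by apply: contraTneq vS => ->; rewrite (disjointFr dXS).
have t2 : t = 2%N.
  have [v vS] : exists v, v \in S by apply/set0Pn; rewrite -card_gt0 cS; lia.
  have [u /setD1P[uv uN]] : exists u, u \in N v :\ v.
    by apply/set0Pn; rewrite -card_gt0 ND; lia.
  have uX := NS v u vS uN uv.
  by have := subset_leq_card (NSX u uX); rewrite (XP u uX).2 ND; nia.
rewrite t2 in cT ND XP *; split=> //.
(* With [t = 2], each vertex has exactly one proper non-neighbour, its partner [p v]. *)
have pP v : exists w, N v :\ v == [set w].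
  have /cards1P[w ->] : #|N v :\ v| == 1%N by rewrite ND.
  by exists w.
pose p v := xchoose (pP v).
have pE v : N v :\ v = [set p v] by apply/eqP/(xchooseP (pP v)).
have p_mem v : p v \in N v :\ v by rewrite pE inE.
have p_uniq v w : w \in N v -> w != v -> w = p v.
  by move=> wN wv; apply/set1P; rewrite -pE !inE wv; rewrite inE in wN.
have pN v : p v \in N v by case/setD1P: (p_mem v).
have pv v : p v != v by case/setD1P: (p_mem v).
have pK : involutive p by move=> v; rewrite -(p_uniq (p v) v) // ?(NC _ v) // eq_sym.
have pS v : v \in S -> p v \in X by move=> vS; apply: NS vS (pN v) (pv v).
(* A vertex of [X] has [(2 - 1) ^ 2 = 1] non-neighbour in [S], which must be its partner. *)
have pX v : v \in X -> p v \in S.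
  move=> vX; have /cards1P[w E] : #|[set w in S | ~~ adj v w]| == 1%N.
    by rewrite (XP v vX).2.
  have : w \in [set w] by rewrite inE.
  rewrite -E => wE; have /setD1P[wv wN] := subsetP (NSX v vX) w wE.
  by rewrite -(p_uniq v w) //; move: wE; rewrite inE => /andP[].
have [t0 [t1 [t01 T2]]] : exists t0 t1, t0 != t1 /\ T = [set t0; t1].
  by have /eqP/cards2P[t0 [t1 [? ->]]] := cT; exists t0, t1.
have t0T : t0 \in T by rewrite T2 set21.
have t1T : t1 \in T by rewrite T2 set22.
have p0 : p t0 = t1 by rewrite -(p_uniq t0 t1) ?NT // eq_sym.
have p1 : p t1 = t0 by rewrite -p0 pK.
have notT v : v \in T -> (v \notin X) /\ (v \notin S).
  by rewrite defT !inE negb_or => /andP.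
have t0A : t0 \notin S by have [] := notT t0 t0T.
(* As [p] swaps [S] with [X] and [t0] with [t1], the set [t0 |: S] of size [s.+1] meets each pair
   once. *)
apply: (@isomorphic_cocktail_party G p (t0 |: S) s) => //.
- by rewrite cardsU1 t0A cS.
- move=> v; have [vT|] := boolP (v \in T).
    move: vT; rewrite T2 => /set2P[] ->.
      by rewrite p0 !inE eqxx eq_sym (negPf t01) (negPf (notT t1 t1T).2).
    by rewrite p1 !inE eqxx eq_sym (negPf t01) (negPf (notT t1 t1T).2).
  rewrite defT inE negbK => /setUP[vX|vS].
    rewrite !inE pX // orbT (disjointFr dXS vX) orbF; apply/esym.
    by apply: contraTneq vX => ->; exact: (notT t0 t0T).1.
  rewrite !inE vS orbT (disjointFr dXS (pS v vS)) orbF /=.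
  by apply: contraTF (pS v vS) => /eqP ->; exact: (notT t0 t0T).1.
- move=> v w; case: eqVneq => [<-|vw] /=; first by rewrite adj_irrefl.
  apply: negb_inj; rewrite negbK.
  apply/idP/eqP => [nvw|->]; last by have := pN v; rewrite inE.
  by apply: p_uniq; rewrite ?inE // eq_sym.
Qed.
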